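(* For all $n\ge1$, we have (a) $c_n(ijjk)=C_n^2$ for every $ijk\in\mathcal{S}_3$; (b) $c_n(1223,1332)=c_n(1332,2113)=c_n(1332,2331)=c_n(1332,3112)=2^{n-1}C_n$; (c) $c_n(1223,2331)=\left(\binom{n}{2}+1\right)C_n$; (d) $c_n(1223,1332,2113)=F_n C_n$; (e) $c_n(1223,1332,2331)=c_n(1332,2113,2331)=c_n(1223,1332,3112)=c_n(1223,2331,3112)=nC_n=\binom{2n}{n-1}$.
   Context: $\mathcal{S}_3$ is the set of permutations of $\{1,2,3\}$ written as words; for $ijk\in\mathcal{S}_3$, $ijjk$ is the length-4 word obtained by repeating the middle letter. A word $\pi=\pi_1\dots\pi_m$ over the positive integers contains the pattern $\sigma=\sigma_1\dots\sigma_k$ if there are indices $1\le i_1<\dots<i_k\le m$ such that for all $r,s\in\{1,\dots,k\}$: $\pi_{i_r}<\pi_{i_s}$ iff $\sigma_r<\sigma_s$, and $\pi_{i_r}=\pi_{i_s}$ iff $\sigma_r=\sigma_s$; otherwise $\pi$ avoids $\sigma$. The set of nonnesting permutations consists of the arrangements (words) of the multiset $\{1,1,2,2,\dots,n,n\}$ that avoid the patterns $1221$ and $2112$. For patterns $\sigma,\tau,\dots$, $c_n(\sigma,\tau,\dots)$ is the number of nonnesting permutations of $\{1,1,2,2,\dots,n,n\}$ avoiding all of $\sigma,\tau,\dots$. $C_n=\frac{1}{n+1}\binom{2n}{n}$ is the $n$th Catalan number, and $F_n$ is the $n$th Fibonacci number with the convention $F_0=F_1=1$ and $F_n=F_{n-1}+F_{n-2}$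 for $n\ge2$. *)

(* Defs.v *)
From mathcomp Require Import all_boot.

Set Implicit Arguments.
Unset Strict Implicit.
Unset Printing Implicit Defensive.

(* [f] gives the positions i_1 < ... < i_k of an occurrence of [s] in [w]; the
   default value 0 of [nth] is never reached. *)
Definition is_occurrence (s w : seq nat)
    (f : {ffun 'I_(size s) -> 'I_(size w)}) : bool :=
  [forall a : 'I_(size s), forall b : 'I_(size s),
    [&& (a < b) ==> (f a < f b),
        (nth 0 w (f a) < nth 0 w (f b)) == (nth 0 s a < nth 0 s b)
      & (nth 0 w (f a) == nth 0 w (f b)) == (nth 0 s a == nth 0 s b)]].

Definition contains (s w : seq nat) : bool :=
  [exists f : {ffun 'I_(size s) -> 'I_(size w)}, is_occurrence f].

Definition avoids (s w : seq nat) : bool := ~~ contains s w.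

(* The word 1 1 2 2 ... n n. *)
Definition doubled (n : nat) : seq nat :=
  flatten [seq [:: i; i] | i <- iota 1 n].

(* [permutations s] lists every distinct rearrangement of [s] exactly once, so
   this list has no duplicates and its size is a cardinality. *)
Definition nonnesting_perms (n : nat) : seq (seq nat) :=
  [seq w <- permutations (doubled n)
     | avoids [:: 1; 2; 2; 1] w & avoids [:: 2; 1; 1; 2] w].

Definition c (n : nat) (ps : seq (seq nat)) : nat :=
  size [seq w <- nonnesting_perms n | all (fun s => avoids s w) ps].

(* The division is exact, see [catalanE]. *)
Definition catalan (n : nat) : nat := 'C(2 * n, n) %/ n.+1.

Lemma catalanE (n : nat) : n.+1 * catalan n = 'C(2 * n, n).
Proof.
rewrite /catalan mulnC divnK //.
have E : n.+1 * 'C(2 * n, n.+1) = n * 'C(2 * n, n).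
  by rewrite mul_bin_left mul2n -addnn addnK.
have : n.+1 %| n * 'C(2 * n, n) by rewrite -E dvdn_mulr.
by rewrite Gauss_dvdr // coprimeSn.
Qed.

(* The convention here is F_0 = F_1 = 1. *)
Fixpoint fib (n : nat) : nat :=
  match n with
  | 0 => 1
  | m.+1 => match m with
            | 0 => 1
            | k.+1 => fib m + fib k
            end
  end.

(* Main.v *)
Require Import Defs.
From mathcomp Require Import all_boot zify.

Set Implicit Arguments.
Unset Strict Implicit.
Unset Printing Implicit Defensive.

(** In a nonnesting word the first copies of the letters and the second copies
    appear in the same order, given by one permutation [p]; the word is
    recovered from [p] and from the places of the first copies, which form a
    ballot sequence.  So every [p] carries [catalan n] words.  This is
    [completions]: reading a word from the left, the letters seen exactly once
    form a queue, and each next letter is either new, hence the next one of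
    [p], or the head of the queue.

    A word contains [i j j k] iff some [a] has a copy before both copies of
    some [b], and some [c] a copy after both of them, in the right relative
    order.  Having a copy before both [b]'s means preceding [b] in [p], and
    having a copy after both means following it, so the word contains [i j j k]
    iff [p] contains [i j k] ([subseq_repeat_middle]).  Therefore each count is
    [catalan n] times a number of permutations avoiding patterns of length 3
    ([c_leaves]), one of those determined by Simion and Schmidt.

    Those are counted by a generating tree: every permutation of size [n + 1]
    is obtained in one way by prepending a letter to one of size [n] and
    shifting the larger letters up ([prepend]).  Avoidance restricts the new
    letter to the sites of the old permutation, and the sites of the child are
    a function of those of the parent and of the chosen one ([site_prepend]).
    The tree is thus described by sets of integers alone ([leaves]).  For each
    of the six single patterns a node with [k] sites has children with
    [2, ..., k + 1] sites, which is the recursion of the ballot numbers; for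
    the sets of two or three patterns the site sets take very few shapes. *)

(** * Ballot numbers *)

(** [ballot a h] counts the lattice words with [a] up steps that start at
    height [h], stay nonnegative and end at height 0: [j] is the height at
    which the first up step starts. *)
Fixpoint ballot (a h : nat) : nat :=
  if a is a'.+1 then \sum_(j < h.+1) ballot a' j.+1 else 1.

Lemma ballotS0 a : ballot a.+1 0 = ballot a 1.
Proof. by rewrite /= big_ord1. Qed.

Lemma ballotSS a h : ballot a.+1 h.+1 = ballot a.+1 h + ballot a h.+2.
Proof. by rewrite /= big_ord_recr. Qed.

(** The reflection principle, obtained here from Pascal's rule. *)
Lemma ballot_reflection a h :
  ballot a.+1 h + 'C(2 * a.+1 + h, a) = 'C(2 * a.+1 + h, a.+1).
Proof.
elim: a h => [|a IHa] h.
  elim: h => [|h IHh]; first by rewrite ballotS0.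
  by move: IHh; rewrite ballotSS /= !bin0 !bin1; lia.
elim: h => [|h IHh].
  have := IHa 1; rewrite ballotS0.
  have -> : 2 * a.+2 + 0 = (2 * a.+1 + 1).+1 by lia.
  (* the two central coefficients of an odd row agree *)
  have : 'C(2 * a.+1 + 1, a.+2) = 'C(2 * a.+1 + 1, a.+1).
    by rewrite -[LHS]bin_sub; [congr 'C(_, _) | ]; lia.
  by move: (2 * a.+1 + 1) => N; rewrite !binS; lia.
rewrite ballotSS; have := IHa h.+2.
have -> : 2 * a.+2 + h.+1 = (2 * a.+2 + h).+1 by lia.
have -> : 2 * a.+1 + h.+2 = 2 * a.+2 + h by lia.
by move: (2 * a.+2 + h) IHh => N; rewrite !binS; lia.
Qed.

Lemma ballot_catalan n : ballot n 0 = catalan n.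
Proof.
apply/eqP; rewrite -(eqn_pmul2l (ltn0Sn n)) catalanE; apply/eqP.
case: n => [|a] //.
have := ballot_reflection a 0; rewrite addn0.
have := mul_bin_left (2 * a.+1) a.
have -> : 2 * a.+1 - a = a.+2 by lia.
by nia.
Qed.

Lemma mul_catalan n : 0 < n -> n * catalan n = 'C(2 * n, n - 1).
Proof.
case: n => // a _; apply/eqP; rewrite -(eqn_pmul2l (ltn0Sn a.+1)) mulnCA catalanE.
rewrite mul_bin_left; apply/eqP; congr (_ * 'C(_, _)); lia.
Qed.

(** * Counting by insertion sites *)

Definition triple : Type := (nat * nat * nat)%type.

(** The relative order of three distinct values is given by three booleans,
    telling whether the pairs (first, second), (first, third) and (second,
    third) are ascents. *)
Definition forbidden (ts : seq triple) (xy xz yz : bool) : bool :=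
  has (fun t => [&& xy == (t.1.1 < t.1.2), xz == (t.1.1 < t.2)
                  & yz == (t.1.2 < t.2)]) ts.

(** Candidates for a new first letter of a permutation of 1, ..., n are named by
    the number [u] of letters below them, from 0 to [n], so that the candidate
    [u] lies below the letter [y] iff [u < y].  After the candidate [v] has
    been prepended, it is the letter [v.+1], and [head_ok] says that the next
    candidate [u] creates no forbidden triple whose second letter is that
    head; the third letter is [z.+1]. *)
Definition head_ok (ts : seq triple) (n v u : nat) : bool :=
  all (fun z => (z == v) || ~~ forbidden ts (u <= v) (u <= z) (v < z))
      (iota 0 n.+1).

(** A triple that starts with the candidate [u] and misses the head [v.+1] was
    already there, at the gap [unbump v u], before [v] was prepended. *)
Definition child_sites (ts : seq triple) (n v : nat) (S : nat -> bool) u :=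
  head_ok ts n v u && S (unbump v u).

(** The number of avoiders reached in [m] steps from one of size [n] whose
    admissible new first letters, its sites, form the set [S].  Nothing else
    has to be known of a node, because [child_sites] only involves [S]. *)
Fixpoint leaves (ts : seq triple) (m n : nat) (S : nat -> bool) : nat :=
  if m is m'.+1 then
    \sum_(0 <= v < n.+1 | S v) leaves ts m' n.+1 (child_sites ts n v S)
  else 1.

Lemma eq_leaves ts m n (S S' : nat -> bool) :
  (forall u, u <= n -> S u = S' u) -> leaves ts m n S = leaves ts m n S'.
Proof.
elim: m n S S' => //= m IHm n S S' eqS.
rewrite big_nat_cond [RHS]big_nat_cond.
apply: eq_big => [v | v /andP[/andP[_ lt_vn] _]].
  by rewrite /= ltnS; case: leqP => //= le_vn; rewrite eqS.
by apply: IHm => u le_un; rewrite /child_sites eqS //; move: le_un; rewrite /unbump; lia.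
Qed.

Lemma leavesS ts m n (S : nat -> bool) (S' : nat -> nat -> bool) :
    (forall v u, v <= n -> S v -> u <= n.+1 -> child_sites ts n v S u = S' v u) ->
  leaves ts m.+1 n S = \sum_(0 <= v < n.+1 | S v) leaves ts m n.+1 (S' v).
Proof.
move=> eqS' /=; rewrite big_nat_cond [RHS]big_nat_cond.
by apply: eq_bigr => v /andP[/andP[_ lt_vn] Sv]; apply: eq_leaves => u; apply: eqS'.
Qed.

Arguments leavesS [ts m n S] S' _.

Lemma leaves_one ts m n a (Sa : nat -> bool) : a <= n ->
    (forall u, u <= n.+1 -> child_sites ts n a (fun u => u == a) u = Sa u) ->
  leaves ts m.+1 n (fun u => u == a) = leaves ts m n.+1 Sa.
Proof.
move=> le_an eqSa; rewrite (leavesS (fun=> Sa)) => [|v u _ /eqP-> le_un]; last first.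
  exact: eqSa.
rewrite -big_filter (@perm_big _ _ _ _ _ [:: a]) ?big_seq1 //.
apply: uniq_perm => [||v]; rewrite ?filter_uniq ?iota_uniq //.
by rewrite mem_filter mem_index_iota !inE; lia.
Qed.

Arguments leaves_one [ts m n a] Sa _ _.

Lemma leaves_two ts m n a b (Sa Sb : nat -> bool) : a < b <= n ->
    (forall u, u <= n.+1 ->
       child_sites ts n a (fun u => (u == a) || (u == b)) u = Sa u) ->
    (forall u, u <= n.+1 ->
       child_sites ts n b (fun u => (u == a) || (u == b)) u = Sb u) ->
  leaves ts m.+1 n (fun u => (u == a) || (u == b)) =
    leaves ts m n.+1 Sa + leaves ts m n.+1 Sb.
Proof.
case/andP=> lt_ab le_bn eqSa eqSb.
rewrite (leavesS (fun v => if v == a then Sa else Sb)); last first.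
  move=> v u _ /orP[] /eqP-> le_un; first by rewrite eqxx eqSa.
  by rewrite gtn_eqF // eqSb.
rewrite -big_filter (@perm_big _ _ _ _ _ [:: a; b]).
  by rewrite big_cons big_seq1 eqxx gtn_eqF.
apply: uniq_perm => [||v]; first by rewrite filter_uniq ?iota_uniq.
  by rewrite /= inE ltn_eqF.
by rewrite mem_filter mem_index_iota !inE; lia.
Qed.

Arguments leaves_two [ts m n a b] Sa Sb _ _ _.

Lemma forbidden_cons t ts xy xz yz :
  forbidden (t :: ts) xy xz yz = forbidden [:: t] xy xz yz || forbidden ts xy xz yz.
Proof. by rewrite /forbidden -[t :: ts]cat1s has_cat. Qed.

Lemma head_ok_cons t t' ts n v u :
  head_ok [:: t, t' & ts] n v u = head_ok [:: t] n v u && head_ok (t' :: ts) n v u.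
Proof.
rewrite /head_ok -all_predI; apply: eq_all => z; rewrite /predI inE.
by rewrite forbidden_cons negb_or orb_andr.
Qed.

Lemma head_ok1P t n v u :
  reflect (forall z, z <= n -> z != v ->
             ~~ [&& (u <= v) == (t.1.1 < t.1.2), (u <= z) == (t.1.1 < t.2)
                  & (v < z) == (t.1.2 < t.2)])
          (head_ok [:: t] n v u).
Proof.
apply: (iffP allP) => [ok z le_zn neq_zv | ok z].
  have /ok : z \in iota 0 n.+1 by rewrite mem_iota.
  by rewrite /forbidden /= orbF (negPf neq_zv).
rewrite mem_iota add0n ltnS => /= le_zn; rewrite /forbidden /= orbF.
by case: eqVneq => //= neq_zv; apply: ok.
Qed.

Ltac head_ok_witness z :=
  apply/head_ok1P/idP => /= [/(_ z) | ]; [| move=> ? ?]; lia.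

Lemma head_ok123 n v u : v <= n -> u <= n.+1 ->
  head_ok [:: (1, 2, 3)] n v u = (v < u) || (v == n).
Proof. by move=> le_vn le_un; head_ok_witness n. Qed.

Lemma head_ok132 n v u : v <= n -> u <= n.+1 ->
  head_ok [:: (1, 3, 2)] n v u = (v <= u).
Proof. by move=> le_vn le_un; head_ok_witness u. Qed.

Lemma head_ok213 n v u : v <= n -> u <= n.+1 ->
  head_ok [:: (2, 1, 3)] n v u = (u <= v) || (u == n.+1).
Proof. by move=> le_vn le_un; head_ok_witness n. Qed.

Lemma head_ok231 n v u : v <= n -> u <= n.+1 ->
  head_ok [:: (2, 3, 1)] n v u = (u == 0) || (v < u).
Proof. by move=> le_vn le_un; head_ok_witness 0. Qed.

Lemma head_ok312 n v u : v <= n -> u <= n.+1 ->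
  head_ok [:: (3, 1, 2)] n v u = (u <= v.+1).
Proof. by move=> le_vn le_un; head_ok_witness v.+1. Qed.

Lemma head_ok321 n v u : v <= n -> u <= n.+1 ->
  head_ok [:: (3, 2, 1)] n v u = (u <= v) || (v == 0).
Proof. by move=> le_vn le_un; head_ok_witness 0. Qed.

Definition head_okE :=
  (head_ok123, head_ok132, head_ok213, head_ok231, head_ok312, head_ok321).

(** * The six single patterns *)

(** The sites taken in increasing order have ranks 0, 1, 2 and so on. *)
Lemma sum_rank (S : pred nat) (F : nat -> nat) n :
  \sum_(0 <= v < n | S v) F (count S (iota 0 v)) =
  \sum_(j < count S (iota 0 n)) F j.
Proof.
elim: n => [|n IHn]; first by rewrite big_geq // big_ord0.
rewrite big_mkcond big_nat_recr // -big_mkcond {}IHn -[in RHS]addn1 iotaD.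
rewrite count_cat /= add0n addn0.
by case: (S n); rewrite ?addn0 // addn1 big_ord_recr.
Qed.

Lemma count_iota_cat (S : pred nat) v n : v < n ->
  count S (iota 0 n) = count S (iota 0 v) + S v + count S (iota v.+1 (n - v.+1)).
Proof.
move=> lt_vn; rewrite -[in LHS](subnKC (ltnW lt_vn)) iotaD count_cat add0n.
by rewrite -[in n - v](prednK (n := n - v)) ?subn_gt0 //= -subnS addnA.
Qed.

Lemma sum_corank (S : pred nat) (F : nat -> nat) n :
  \sum_(0 <= v < n | S v) F (count S (iota 0 n) - (count S (iota 0 v)).+1) =
  \sum_(j < count S (iota 0 n)) F j.
Proof.
rewrite (sum_rank S (fun k => F (count S (iota 0 n) - k.+1))).
by rewrite (reindex_inj rev_ord_inj) /=; apply: eq_bigr => j _; congr F; have := ltn_ord j; lia.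
Qed.

Lemma sum_leq (F : nat -> nat) n r : r <= n ->
  \sum_(0 <= v < n.+1 | v <= r) F v = \sum_(j < r.+1) F j.
Proof.
by move=> le_rn; rewrite -(big_mkord xpredT) (@big_nat_widen _ _ _ 0 r.+1 n.+1).
Qed.

Lemma sum_geq (F : nat -> nat) n r : r <= n ->
  \sum_(0 <= v < n.+1 | r <= v) F (n - v) = \sum_(j < (n - r).+1) F j.
Proof.
move=> le_rn; rewrite big_nat_rev -(@sum_leq _ n) ?leq_subr //.
rewrite big_nat_cond [RHS]big_nat_cond.
by apply: eq_big => [v | v /andP[/andP[_ lt_vn] _]]; [| congr F]; lia.
Qed.

(** Choosing the site [n] leaves the left end of the interval of sites where it
    is, while any other site [v] moves it to [v.+1]. *)
Lemma leaves123 m n r : r <= n ->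
  leaves [:: (1, 2, 3)] m n (fun u => r <= u) = ballot m (n - r).
Proof.
elim: m n r => // m IHm n r le_rn.
rewrite (leavesS (fun v u => (if v == n then r else v.+1) <= u)); last first.
  move=> v u le_vn le_rv le_un; rewrite /child_sites head_okE // /unbump.
  by move: le_rv; case: eqP; lia.
rewrite [RHS]/= big_ord_recr big_mkcond big_nat_recr //= -big_mkcond.
rewrite le_rn eqxx IHm ?leqW // subSn //; congr (_ + _).
case: n le_rn => [|n] le_rn; first by rewrite big_geq // big_ord0.
have [-> | lt_rn] := eqVneq r n.+1.
  by rewrite subnn big_ord0 big_nat_cond big_pred0 // => v; lia.
have {lt_rn}le_rn : r <= n by lia.
rewrite subSn // -(sum_geq (fun j => ballot m j.+1) le_rn).
rewrite big_nat_cond [RHS]big_nat_cond; apply: eq_bigr => v /andP[/andP[_ lt_vn] _].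
by rewrite ltn_eqF // IHm; [congr (ballot m _) |]; lia.
Qed.

(** A letter below the head would be followed by the head and by a letter between
    the two, so the sites of the child start at [v]. *)
Lemma leaves132 m n r : r <= n ->
  leaves [:: (1, 3, 2)] m n (fun u => r <= u) = ballot m (n - r).
Proof.
elim: m n r => // m IHm n r le_rn.
rewrite (leavesS (fun v u => v <= u)); last first.
  by move=> v u le_vn le_rv le_un; rewrite /child_sites head_okE // /unbump; lia.
rewrite /= -(sum_geq (fun j => ballot m j.+1) le_rn).
rewrite big_nat_cond [RHS]big_nat_cond; apply: eq_bigr => v /andP[/andP[_ lt_vn] _].
by rewrite IHm ?subSn // ltnW.
Qed.

Lemma leaves312 m n r : r <= n ->
  leaves [:: (3, 1, 2)] m n (fun u => u <= r) = ballot m r.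
Proof.
elim: m n r => // m IHm n r le_rn.
rewrite (leavesS (fun v u => u <= v.+1)); last first.
  by move=> v u le_vn le_rv le_un; rewrite /child_sites head_okE // /unbump; lia.
rewrite sum_leq //=; apply: eq_bigr => v _; apply: IHm.
by have := ltn_ord v; lia.
Qed.

Lemma leaves321 m n r : r <= n ->
  leaves [:: (3, 2, 1)] m n (fun u => u <= r) = ballot m r.
Proof.
elim: m n r => // m IHm n r le_rn.
rewrite (leavesS (fun v u => u <= (if v == 0 then r.+1 else v))); last first.
  move=> v u le_vn le_rv le_un; rewrite /child_sites head_okE // /unbump.
  by move: le_rv; case: eqP; lia.
rewrite sum_leq // big_ord_recl [RHS]/= big_ord_recr addnC /=; congr (_ + _); last exact: IHm.
by apply: eq_bigr => v _; apply: (IHm n.+1 v.+1); have := ltn_ord v; lia.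
Qed.

(** The sites need not form an interval here, but the child keeps those up to
    [v] and gains the largest gap, so only the rank of [v] matters.  The site
    [n] is always present and is left out of the count. *)
Lemma leaves213 m n (S : pred nat) : S n ->
  leaves [:: (2, 1, 3)] m n S = ballot m (count S (iota 0 n)).
Proof.
elim: m n S => // m IHm n S Sn.
rewrite (leavesS (fun v u => (u <= v) && S u || (u == n.+1))); last first.
  move=> v u le_vn Sv le_un; rewrite /child_sites head_okE //.
  case: (leqP u v) => [le_uv | lt_vu] /=.
    by rewrite /unbump ltnNge le_uv subn0; case: eqP => [|_]; [lia | rewrite orbF].
  by case: eqP => //= ->; rewrite /unbump ltnS le_vn subn1.
have -> : ballot m.+1 (count S (iota 0 n)) = \sum_(j < count S (iota 0 n.+1)) ballot m j.+1.
  by rewrite -[n.+1]addn1 iotaD count_cat /= add0n Sn addn0 addn1.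
rewrite -(sum_rank S (fun j => ballot m j.+1)).
rewrite big_nat_cond [RHS]big_nat_cond; apply: eq_bigr => v /andP[/andP[_ lt_vn] Sv].
rewrite IHm ?eqxx ?orbT //; congr (ballot m _).
rewrite (count_iota_cat _ lt_vn) leqnn Sv /= [X in _ + X](_ : _ = 0).
  rewrite addn0 addn1; congr _.+1.
  by apply: eq_in_count => u; rewrite mem_iota /= => lt_uv; case: (S u); lia.
apply/eqP; rewrite -leqn0 leqNgt -has_count; apply/hasPn => u.
by rewrite mem_iota; lia.
Qed.

(** The mirror image of the previous case: the sites from [v] on are kept, moved
    up by one, and 0 is always a site. *)
Lemma leaves231 m n (S : pred nat) : S 0 ->
  leaves [:: (2, 3, 1)] m n S = ballot m (count S (iota 1 n)).
Proof.
elim: m n S => // m IHm n S S0.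
rewrite (leavesS (fun v u => (u == 0) || (v < u) && S u.-1)); last first.
  move=> v u le_vn Sv le_un; rewrite /child_sites head_okE // /unbump.
  by case: (ltnP v u) => [lt_vu | le_uv]; case: eqP => [->|_] //=; rewrite ?subn1.
have -> : ballot m.+1 (count S (iota 1 n)) = \sum_(j < count S (iota 0 n.+1)) ballot m j.+1.
  by rewrite /= S0.
rewrite -(sum_corank S (fun j => ballot m j.+1)).
rewrite big_nat_cond [RHS]big_nat_cond; apply: eq_bigr => v /andP[/andP[_ lt_vn] Sv].
rewrite IHm ?eqxx //; congr (ballot m _).
rewrite (count_iota_cat S lt_vn) Sv addn1 addKn.
rewrite -[1]addn0 iotaDl count_map.
rewrite (@eq_count _ _ (fun u => (v <= u) && S u)) // (count_iota_cat _ lt_vn) leqnn Sv /=.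
rewrite [X in X + _](_ : _ = 1).
  by congr _.+1; apply: eq_in_count => u; rewrite mem_iota => /andP[/ltnW ->].
rewrite addn1; congr _.+1; apply/eqP; rewrite -leqn0 leqNgt -has_count.
by apply/hasPn => u; rewrite mem_iota; lia.
Qed.

(** * Sets of several patterns *)

(** The single letter 1 forms no triple with one new letter, so both its gaps
    are sites; the shapes below are stable only from that node on. *)
Lemma leaves_root ts m : leaves ts m.+1 0 xpredT = leaves ts m 1 xpredT.
Proof.
rewrite (leavesS (fun=> xpredT)) ?big_nat1 // => v u.
by rewrite leqn0 => /eqP-> _ _; rewrite /child_sites /head_ok.
Qed.

Ltac child := rewrite /child_sites ?head_ok_cons ?head_okE // /unbump; lia.

Lemma leaves_123_132 m n :
  leaves [:: (1, 2, 3); (1, 3, 2)] m n.+1 (fun u => (u == n) || (u == n.+1)) = 2 ^ m.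
Proof.
elim: m n => // m IHm n.
rewrite (leaves_two (fun u => (u == n.+1) || (u == n.+2))
                    (fun u => (u == n.+1) || (u == n.+2))).
- by rewrite IHm expnS mul2n addnn.
- by lia.
- by move=> u le_un; child.
- by move=> u le_un; child.
Qed.

Lemma leaves_132_213 m n h : h < n ->
  leaves [:: (1, 3, 2); (2, 1, 3)] m n (fun u => (u == h) || (u == n)) = 2 ^ m.
Proof.
elim: m n h => // m IHm n h lt_hn.
rewrite (leaves_two (fun u => (u == h) || (u == n.+1))
                    (fun u => (u == n) || (u == n.+1))).
- by rewrite !IHm ?expnS ?mul2n ?addnn // ltnW.
- by lia.
- by move=> u le_un; child.
- by move=> u le_un; child.
Qed.

Lemma leaves_132_312 m n h : h < n ->
  leaves [:: (1, 3, 2); (3, 1, 2)] m n (fun u => (u == h) || (u == h.+1)) = 2 ^ m.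
Proof.
elim: m n h => // m IHm n h lt_hn.
rewrite (leaves_two (fun u => (u == h) || (u == h.+1))
                    (fun u => (u == h.+1) || (u == h.+2))).
- by rewrite !IHm ?expnS ?mul2n ?addnn // ltnW.
- by lia.
- by move=> u le_un; child.
- by move=> u le_un; child.
Qed.

Lemma sum_bin_diag m n : \sum_(j < n.+1) 'C(m + j, m) = 'C(m.+1 + n, m.+1).
Proof.
elim: n => [|n IHn]; first by rewrite big_ord1 !addn0 !binn.
by rewrite big_ord_recr IHn /= (addnS m.+1) binS addSnnS.
Qed.

(** Once 0 is no longer a site, choosing [v] discards the smaller sites only, so a
    node with [k] sites has one child with each number of sites from 1 to [k]. *)
Lemma leaves_132_231_upper m n r : 0 < r <= n ->
  leaves [:: (1, 3, 2); (2, 3, 1)] m n (fun u => r <= u) = 'C(m + (n - r), m).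
Proof.
elim: m n r => [|m IHm] n r /andP[r_gt0 le_rn]; first by rewrite bin0.
rewrite (leavesS (fun v u => v < u)); last by move=> v u le_vn le_rv le_un; child.
rewrite -sum_bin_diag -(sum_geq (fun j => 'C(m + j, m)) le_rn).
rewrite big_nat_cond [RHS]big_nat_cond; apply: eq_bigr => v /andP[/andP[_ lt_vn] _].
by rewrite IHm ?subSS.
Qed.

(** Only the increasing permutation has all gaps as sites.  Its child at 0 is
    again increasing and contributes the partial row sum for [m]; the others
    contribute the next entry of the row. *)
Lemma leaves_132_231 m n :
  leaves [:: (1, 3, 2); (2, 3, 1)] m n.+1 xpredT = \sum_(i < m.+1) 'C(m + n, i).
Proof.
elim: m n => [|m IHm] n; first by rewrite big_ord1 bin0.
rewrite (leavesS (fun v u => (v == 0) || (v < u))); last first.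
  by move=> v u le_vn _ le_un; child.
rewrite big_nat_recl // IHm addSnnS [RHS]big_ord_recr /=; congr (_ + _).
rewrite addnS -addSn -sum_bin_diag -[in RHS](subn0 n).
rewrite -(sum_geq (fun j => 'C(m + j, m)) (leq0n n)) /=.
rewrite big_nat [RHS]big_nat; apply: eq_bigr => v /andP[_ lt_vn].
by rewrite leaves_132_231_upper ?subSS.
Qed.

Lemma leaves_123_231_one m n : 0 < n ->
  leaves [:: (1, 2, 3); (2, 3, 1)] m n (fun u => u == n) = 1.
Proof.
elim: m n => // m IHm n n_gt0.
by rewrite (leaves_one (fun u => u == n.+1)) ?IHm // => u le_un; child.
Qed.

Lemma leaves_123_231_two m n h : 0 < h < n ->
  leaves [:: (1, 2, 3); (2, 3, 1)] m n (fun u => (u == h) || (u == n)) = m.+1.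
Proof.
elim: m n h => // m IHm n h lt_0hn.
rewrite (leaves_two (fun u => (u == h.+1) || (u == n.+1))
                    (fun u => u == n.+1)).
- by rewrite IHm ?leaves_123_231_one ?addn1 //; lia.
- by lia.
- by move=> u le_un; child.
- by move=> u le_un; child.
Qed.

(** The sites [0] and [n] belong to the decreasing permutation; [n] keeps it
    decreasing, and 0 leads to a node with sites [1] and [n.+1], which spawns
    one one-site chain per step. *)
Lemma leaves_123_231 m n : 0 < n ->
  leaves [:: (1, 2, 3); (2, 3, 1)] m n (fun u => (u == 0) || (u == n)) = 'C(m.+1, 2) + 1.
Proof.
elim: m n => // m IHm n n_gt0.
rewrite (leaves_two (fun u => (u == 1) || (u == n.+1))
                    (fun u => (u == 0) || (u == n.+1))).
- by rewrite IHm // leaves_123_231_two // [in RHS]binS bin1; lia.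
- by lia.
- by move=> u le_un; child.
- by move=> u le_un; child.
Qed.

(** The Fibonacci rule: a node with the single site [n] has one child, with two
    sites, and a node with two sites has one child of either kind. *)
Lemma leaves_123_132_213 m n :
  leaves [:: (1, 2, 3); (1, 3, 2); (2, 1, 3)] m n (fun u => u == n) = fib m /\
  leaves [:: (1, 2, 3); (1, 3, 2); (2, 1, 3)] m n.+1 (fun u => (u == n) || (u == n.+1))
    = fib m.+1.
Proof.
elim: m n => // m IHm n; split.
  rewrite (leaves_one (fun u => (u == n) || (u == n.+1))) //; first by case: (IHm n).
  by move=> u le_un; child.
rewrite (leaves_two (fun u => u == n.+2)
                    (fun u => (u == n.+1) || (u == n.+2))).
- by rewrite (IHm n.+2).1 (IHm n.+1).2 addnC.
- by lia.
- by move=> u le_un; child.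
- by move=> u le_un; child.
Qed.

(** A node with two sites has one child like itself and one child that starts an unbranched chain, hence one new leaf per step. *)
Lemma leaves_123_132_231 m n :
  leaves [:: (1, 2, 3); (1, 3, 2); (2, 3, 1)] m n.+1 (fun u => (u == n) || (u == n.+1))
    = m.+1.
Proof.
have one k l : 0 < l ->
    leaves [:: (1, 2, 3); (1, 3, 2); (2, 3, 1)] k l (fun u => u == l) = 1.
  elim: k l => // k IHk l l_gt0.
  by rewrite (leaves_one (fun u => u == l.+1)) ?IHk // => u le_ul; child.
elim: m n => // m IHm n.
rewrite (leaves_two (fun u => (u == n.+1) || (u == n.+2))
                    (fun u => u == n.+2)).
- by rewrite IHm one // addn1.
- by lia.
- by move=> u le_un; child.
- by move=> u le_un; child.
Qed.

Lemma leaves_132_213_231 m n : 0 < n ->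
  leaves [:: (1, 3, 2); (2, 1, 3); (2, 3, 1)] m n (fun u => (u == 0) || (u == n))
    = m.+1.
Proof.
have one k l : 0 < l ->
    leaves [:: (1, 3, 2); (2, 1, 3); (2, 3, 1)] k l (fun u => u == l) = 1.
  elim: k l => // k IHk l l_gt0.
  by rewrite (leaves_one (fun u => u == l.+1)) ?IHk // => u le_ul; child.
elim: m n => // m IHm n n_gt0.
rewrite (leaves_two (fun u => (u == 0) || (u == n.+1))
                    (fun u => u == n.+1)).
- by rewrite IHm ?one // addn1.
- by lia.
- by move=> u le_un; child.
- by move=> u le_un; child.
Qed.

Lemma leaves_123_132_312 m n :
  leaves [:: (1, 2, 3); (1, 3, 2); (3, 1, 2)] m n.+1 (fun u => (u == n) || (u == n.+1))
    = m.+1.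
Proof.
have one k l : leaves [:: (1, 2, 3); (1, 3, 2); (3, 1, 2)] k l.+1 (fun u => u == l) = 1.
  elim: k l => // k IHk l.
  by rewrite (leaves_one (fun u => u == l.+1)) ?IHk // => u le_ul; child.
elim: m n => // m IHm n.
rewrite (leaves_two (fun u => u == n.+1)
                    (fun u => (u == n.+1) || (u == n.+2))).
- by rewrite IHm one.
- by lia.
- by move=> u le_un; child.
- by move=> u le_un; child.
Qed.

Lemma leaves_123_231_312 m n : 0 < n ->
  leaves [:: (1, 2, 3); (2, 3, 1); (3, 1, 2)] m n (fun u => (u == 0) || (u == n))
    = m.+1.
Proof.
have one k l h : 0 < h < l ->
    leaves [:: (1, 2, 3); (2, 3, 1); (3, 1, 2)] k l (fun u => u == h) = 1.
  elim: k l h => // k IHk l h lt_0hl; have le_hl : h <= l by lia.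
  rewrite (leaves_one (fun u => u == h.+1)) ?IHk //; first by lia.
  by move=> u le_ul; child.
elim: m n => // m IHm n n_gt0.
rewrite (leaves_two (fun u => u == 1)
                    (fun u => (u == 0) || (u == n.+1))).
- by rewrite IHm ?one.
- by lia.
- by move=> u le_un; child.
- by move=> u le_un; child.
Qed.

(** * Permutations built by prepending *)

Fixpoint avoids3 (ts : seq triple) (s : seq nat) : bool :=
  if s is x :: s' then
    pairwise (fun y z => ~~ forbidden ts (x < y) (x < z) (y < z)) s' && avoids3 ts s'
  else true.

Definition prepend (v : nat) (s : seq nat) : seq nat :=
  v.+1 :: map (bump v.+1) s.

Definition site (ts : seq triple) (s : seq nat) (u : nat) : bool :=
  pairwise (fun y z => ~~ forbidden ts (u < y) (u < z) (y < z)) s.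

Lemma ltn_bump v u y : (u < bump v.+1 y) = (unbump v u < y).
Proof. by rewrite leq_bump unbumpS. Qed.

Lemma ltn_bump2 v y z : (bump v y < bump v z) = (y < z).
Proof. by rewrite ltnNge leq_bump2 -ltnNge. Qed.

Lemma avoids3_prepend ts v s :
  avoids3 ts (prepend v s) = site ts s v && avoids3 ts s.
Proof.
rewrite /= pairwise_map; congr (_ && _).
  apply: eq_pairwise => y z /=; rewrite ltn_bump2 !leq_bump.
  by have -> : unbump v.+1 v.+2 = v.+1 by rewrite /unbump ltnSn subn1.
elim: s => //= x s ->; congr (_ && _); rewrite pairwise_map.
by apply: eq_pairwise => y z /=; rewrite !ltn_bump2.
Qed.

(** Split the pairs of letters of [prepend v s] into those that contain the head
    and those that do not. *)
Lemma site_prepend ts n v s u : perm_eq s (iota 1 n) -> v <= n ->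
  site ts (prepend v s) u = child_sites ts n v (site ts s) u.
Proof.
move=> s_perm le_vn; rewrite /site /child_sites /=; congr (_ && _); last first.
  by rewrite pairwise_map; apply: eq_pairwise => y z /=; rewrite ltn_bump2 !ltn_bump.
rewrite all_map (perm_all _ s_perm); apply/allP/allP => ok z.
  rewrite mem_iota => z_in /=; case: eqVneq => //= neq_zv.
  have {}ok y : y \in iota 1 n ->
      ~~ forbidden ts (u < v.+1) (u < bump v.+1 y) (v.+1 < bump v.+1 y) := ok y.
  have := ok (unbump v z).+1; rewrite -unbumpS unbumpK ?inE // !ltnS; apply.
  by rewrite mem_iota unbumpS; move: neq_zv; rewrite /unbump; lia.
case: z => [|z]; rewrite mem_iota // => z_in.
have := ok (bump v z); rewrite mem_iota eq_sym (negPf (neq_bump _ _)) /=.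
by rewrite bumpS !ltnS; apply; rewrite /bump; lia.
Qed.

Lemma perm_permutations_prepend n :
  perm_eq (permutations (iota 1 n.+1))
          [seq prepend v s | s <- permutations (iota 1 n), v <- iota 0 n.+1].
Proof.
apply: uniq_perm => [||t]; first exact: permutations_uniq.
  apply: allpairs_uniq; [exact: permutations_uniq | exact: iota_uniq |].
  move=> [s v] [s' v'] _ _ [<- /inj_map eq_s]; congr (_, _).
  exact: eq_s (can_inj (bumpK _)).
rewrite mem_permutations; apply/idP/allpairsP => [t_perm | [[s v] /=]].
  case: t t_perm => [|x t] t_perm; first by have := perm_size t_perm.
  have x_in : x \in iota 1 n.+1 by rewrite -(perm_mem t_perm) mem_head.
  have t_uniq : uniq (x :: t) by rewrite (perm_uniq t_perm) iota_uniq.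
  rewrite mem_iota in x_in.
  have notx y : y \in t -> y != x.
    by move=> y_t; apply: contraTneq y_t => ->; case/andP: t_uniq.
  exists (map (unbump x) t, x.-1) => /=; split.
  - rewrite mem_permutations; apply: uniq_perm; rewrite ?iota_uniq //.
      rewrite map_inj_in_uniq; first by case/andP: t_uniq.
      by move=> y z /notx ? /notx ?; apply: (can_in_inj (unbumpK (h := x))).
    move=> y; rewrite mem_iota; apply/mapP/idP => [[z z_t ->] | y_in].
      have := perm_mem t_perm z; rewrite inE z_t orbT mem_iota => /esym.
      by have := notx z z_t; rewrite /unbump; lia.
    exists (bump x y); last by rewrite bumpK.
    have := perm_mem t_perm (bump x y).
    rewrite inE eq_sym (negPf (neq_bump _ _)) mem_iota /= => ->.
    by rewrite /bump; lia.
  - by rewrite inE mem_iota; lia.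
  - rewrite /prepend prednK; last by lia.
    congr (_ :: _); rewrite -map_comp -[LHS]map_id; apply/eq_in_map => y /notx neq_yx /=.
    by rewrite unbumpK.
rewrite mem_permutations inE mem_iota => -[s_perm le_vn ->].
have s_uniq : uniq s by rewrite (perm_uniq s_perm) iota_uniq.
apply: uniq_perm => [||y]; [|exact: (iota_uniq 1 n.+1)|].
  rewrite /= map_inj_uniq ?s_uniq ?andbT; last exact: can_inj (bumpK _).
  by apply/mapP => -[y _ /eqP]; apply/negP/neq_bump.
rewrite !inE mem_iota; case: (eqVneq y v.+1) => [-> | neq_yv] /=; first by lia.
apply/mapP/idP => [[z z_s ->] | y_in].
  by have := perm_mem s_perm z; rewrite z_s mem_iota /bump; lia.
exists (unbump v.+1 y); last by rewrite unbumpK.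
by rewrite (perm_mem s_perm) mem_iota; move: neq_yv; rewrite /unbump; lia.
Qed.

(** The number of avoiders of size [m + n], sorted by the permutation of size
    [n] from which they grow. *)
Lemma sum_leaves_site ts m n :
  \sum_(s <- permutations (iota 1 n) | avoids3 ts s) leaves ts m n (site ts s) =
  count (avoids3 ts) (permutations (iota 1 (m + n))).
Proof.
elim: m n => [|m IHm] n; first by rewrite sum1_count.
rewrite addSnnS -IHm [RHS](perm_big _ (perm_permutations_prepend n)).
rewrite big_mkcond [RHS]big_mkcond big_allpairs_dep.
rewrite big_seq [RHS]big_seq; apply: eq_bigr => s; rewrite mem_permutations => s_perm.
rewrite (leavesS (fun v => child_sites ts n v (site ts s))) //.
case: ifP => s_avoids; last first.
  by rewrite big1 // => v _; rewrite avoids3_prepend s_avoids andbF.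
rewrite -[iota 0 n.+1]/(index_iota 0 n.+1).
rewrite [LHS]big_mkcond [LHS]big_nat [RHS]big_nat; apply: eq_bigr => v /andP[_ lt_vn].
rewrite avoids3_prepend s_avoids andbT; case: ifP => // _.
by apply: eq_leaves => u _; rewrite (site_prepend _ _ s_perm).
Qed.

Lemma count_avoids3 ts n :
  count (avoids3 ts) (permutations (iota 1 n)) = leaves ts n 0 xpredT.
Proof.
rewrite -[n in LHS]addn0 -sum_leaves_site (perm_big [:: [::]]) ?big_cons ?big_nil //=.
by rewrite addn0.
Qed.

(** * Occurrences as subsequences *)

Definition same_order (s t : seq nat) : Prop :=
  size t = size s /\
  forall a b, a < size s -> b < size s ->
    (nth 0 t a < nth 0 t b) = (nth 0 s a < nth 0 s b) /\
    (nth 0 t a == nth 0 t b) = (nth 0 s a == nth 0 s b).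

Lemma containsP s w :
  reflect (exists2 t, subseq t w & same_order s t) (contains s w).
Proof.
apply: (iffP existsP) => [[f /forallP f_occ] | [t /subseqP[m m_size ->]]].
  exists [seq nth 0 w (f a) | a <- enum 'I_(size s)].
    rewrite (map_comp (nth 0 w) (fun a => nat_of_ord (f a))).
    rewrite -[X in subseq _ X](mkseq_nth 0 w); apply: map_subseq.
    have -> : [seq nat_of_ord (f a) | a <- enum 'I_(size s)] =
        [seq i <- iota 0 (size w) |
           i \in [seq nat_of_ord (f a) | a <- enum 'I_(size s)]].
      apply: (irr_sorted_eq ltn_trans ltnn).
      + rewrite sorted_map; apply/(sub_sorted (e := relpre val ltn)).
          by move=> a b /= lt_ab; have /forallP/(_ b)/and3P[/implyP->] := f_occ a.
        by rewrite -(sorted_map (f := val)) val_enum_ord iota_ltn_sorted.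
      + by apply: sorted_filter; [exact: ltn_trans | exact: iota_ltn_sorted].
      + move=> i; rewrite mem_filter mem_iota; case: (boolP (i \in _)) => //=.
        by case/mapP=> a _ ->; rewrite ltn_ord.
    exact: filter_subseq.
  split=> [|a b lt_a lt_b]; first by rewrite size_map size_enum_ord.
  have nthE c (lt_c : c < size s) :
      nth 0 [seq nth 0 w (f a) | a <- enum 'I_(size s)] c = nth 0 w (f (Ordinal lt_c)).
    rewrite (nth_map (Ordinal lt_c)) ?size_enum_ord //.
    by congr (nth _ _ (f _)); apply: val_inj; rewrite /= nth_enum_ord.
  rewrite (nthE _ lt_a) (nthE _ lt_b).
  by have /forallP/(_ (Ordinal lt_b))/and3P[_ /eqP-> /eqP->] := f_occ (Ordinal lt_a).
rewrite -{1}(mkseq_nth 0 w) /mkseq -map_mask.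
set ks := mask m (iota 0 (size w)).
have ks_lt i : i \in ks -> i < size w by move=> /mem_mask; rewrite mem_iota.
have ks_sorted : sorted ltn ks.
  by apply: subseq_sorted (mask_subseq _ _) (iota_ltn_sorted _ _); exact: ltn_trans.
case=> size_t t_order; rewrite size_map in size_t.
have nth_lt (a : 'I_(size s)) : nth 0 ks a < size w.
  by apply/ks_lt/mem_nth; rewrite size_t.
exists [ffun a => Ordinal (nth_lt a)]; apply/forallP => a; apply/forallP => b.
rewrite !ffunE /=; have [] := t_order a b (ltn_ord a) (ltn_ord b).
rewrite !(nth_map 0) ?size_t // => -> ->; rewrite !eqxx !andbT.
apply/implyP; apply: (sorted_ltn_nth ltn_trans); by rewrite ?inE ?size_t.
Qed.

(** * Nonnesting words *)

Definition nonnesting (w : seq nat) : Prop :=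
  forall x y, x != y -> ~~ subseq [:: x; y; y; x] w.

(** The possible remainders of a nonnesting word, when [q] lists the letters
    seen once, in order, and [p] the unseen letters in the order of their first
    copies. *)
Fixpoint completions (p : seq nat) : seq nat -> seq (seq nat) :=
  if p is x :: p' then
    fix completions_p (q : seq nat) : seq (seq nat) :=
      if q is y :: q' then
        map (cons x) (completions p' (rcons q x)) ++ map (cons y) (completions_p q')
      else map (cons x) (completions p' [:: x])
  else fun q => [:: q].

Lemma completions0 x p :
  completions (x :: p) [::] = map (cons x) (completions p [:: x]).
Proof. by []. Qed.

Lemma completionsS x p y q :
  completions (x :: p) (y :: q) =
    map (cons x) (completions p (y :: rcons q x)) ++
    map (cons y) (completions (x :: p) q).
Proof. by []. Qed.

Lemma size_completions p q : size (completions p q) = ballot (size p) (size q).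
Proof.
elim: p q => // x p IHp; elim=> [|y q IHq].
  by rewrite completions0 size_map IHp ballotS0.
by rewrite completionsS size_cat !size_map IHp IHq ballotSS addnC /= size_rcons.
Qed.

Lemma completions_uniq p q : uniq (q ++ p) -> uniq (completions p q).
Proof.
elim: p q => // x p IHp; elim=> [|y q IHq] qp_uniq.
  by rewrite completions0 map_inj_uniq ?IHp // => ? ? [].
rewrite completionsS cat_uniq !map_inj_uniq; try by move=> ? ? [].
rewrite IHp /=; last by rewrite -cats1 -catA.
rewrite IHq ?andbT; last by case/andP: qp_uniq.
apply/hasPn => _ /mapP[w _ ->]; apply/mapP => -[w' _ [eq_yx _]].
by move: qp_uniq; rewrite /= eq_yx mem_cat mem_head orbT.
Qed.

Lemma completions_ind (P : seq nat -> seq nat -> seq nat -> Prop) :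
    (forall q, P [::] q q) ->
    (forall x p q w, w \in completions p (rcons q x) -> P p (rcons q x) w ->
       P (x :: p) q (x :: w)) ->
    (forall p y q w, w \in completions p q -> P p q w -> P p (y :: q) (y :: w)) ->
  forall p q w, w \in completions p q -> P p q w.
Proof.
move=> Pnil Pfirst Psecond; elim=> [|x p IHp]; first by move=> q w; rewrite inE => /eqP->.
elim=> [|y q IHq] w.
  rewrite completions0 => /mapP[w' w'_in ->].
  exact: (Pfirst x p [::] w' w'_in (IHp _ _ w'_in)).
rewrite completionsS mem_cat => /orP[] /mapP[w' w'_in ->].
  exact: (Pfirst x p (y :: q) w' w'_in (IHp _ _ w'_in)).
by apply: Psecond w'_in (IHq _ w'_in).
Qed.

Lemma completions_first x p q w :
  w \in completions p (rcons q x) -> x :: w \in completions (x :: p) q.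
Proof.
case: q => [|y q] w_in; first by rewrite completions0 map_f.
by rewrite completionsS mem_cat map_f.
Qed.

Lemma completions_second p y q w :
  w \in completions p q -> y :: w \in completions p (y :: q).
Proof.
case: p => [|x p]; first by rewrite !inE => /eqP->.
by move=> w_in; rewrite completionsS mem_cat orbC map_f.
Qed.

Lemma perm_completions p q w : w \in completions p q -> perm_eq w (q ++ p ++ p).
Proof.
move: p q w; apply: completions_ind => [q | x p q w _ IHw | p y q w _ IHw] /=.
- by rewrite cats0.
- apply/permP => a; have /permP/(_ a) := IHw.
  by rewrite -cats1 !count_cat /= count_cat /=; lia.
- by rewrite perm_cons.
Qed.

(** [undup] keeps the last copy of each letter, and the second copies come in the
    order of the queue. *)
Lemma undup_completions p q w :
  uniq (q ++ p) -> w \in completions p q -> undup w = q ++ p.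
Proof.
move=> qp_uniq w_in; move: p q w w_in qp_uniq.
apply: completions_ind => [q | x p q w w_in IHw | p y q w w_in IHw] /=.
- by rewrite cats0 => /undup_id.
- rewrite -cat_rcons => qp_uniq; rewrite IHw // (perm_mem (perm_completions w_in)).
  by rewrite mem_cat mem_rcons mem_head.
- case/andP=> y_notin qp_uniq; rewrite IHw // (perm_mem (perm_completions w_in)).
  by move: y_notin; rewrite !mem_cat => /norP[/negPf-> /negPf->].
Qed.

Lemma subseq_remove (s t1 t2 : seq nat) x : x \notin s ->
  subseq s (t1 ++ x :: t2) = subseq s (t1 ++ t2).
Proof.
move=> x_notin; have s_neqx : all (predC1 x) s.
  by apply/allP => y y_s; apply: contraNneq x_notin => <-.
rewrite -[LHS]andTb -[RHS]andTb -[in LHS]s_neqx -[in RHS]s_neqx -!subseq_filter.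
by rewrite !filter_cat /= eqxx.
Qed.

(** Since [b :: t] already needs all the copies of [b] on the right, the marked
    [b] can only be matched with the marked [b]. *)
Lemma subseq_pivot (b : nat) (s t w1 w2 : seq nat) :
    b \notin s -> b \notin w1 -> count_mem b w2 <= count_mem b t ->
  subseq (s ++ b :: t) (w1 ++ b :: w2) = subseq s w1 && subseq t w2.
Proof.
elim: w1 s => [|y w1 IHw] s b_s b_w1 le_count.
  case: s b_s => [|a s] /=; first by rewrite eqxx.
  rewrite inE negb_or eq_sym => /andP[/negPf-> _].
  apply/negP => /(leq_count_subseq (pred1 b))/leq_trans/(_ le_count).
  rewrite leqNgt /= count_cat /= eqxx addnA => /negP[]; exact: leq_addl.
move: b_w1; rewrite inE negb_or => /andP[neq_by b_w1].
case: s b_s => [|a s] /=.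
  have /= IHw0 := IHw [::] isT b_w1 le_count.
  by rewrite (negPf neq_by) IHw0 sub0seq.
rewrite inE negb_or => /andP[neq_ba b_s].
case: eqVneq => [_ | neq_ay]; first exact: IHw.
by rewrite -cat_cons IHw // inE negb_or neq_ba.
Qed.

Lemma split_first (b : nat) (w : seq nat) : b \in w ->
  exists w1 w2, w = w1 ++ b :: w2 /\ b \notin w1.
Proof.
elim: w => // y w IHw; rewrite inE; case: eqVneq => [-> _ | neq_by /= /IHw].
  by exists [::], w.
by case=> w1 [w2 [-> b_w1]]; exists (y :: w1), w2; rewrite inE negb_or neq_by.
Qed.

(** The order of the last occurrences, which is [undup w], is also the order of
    the first ones: if [a] and [b] came in opposite orders at the two ends, one
    of them would be nested in the other. *)
Lemma subseq_repeat_middle (w : seq nat) (a b c : nat) :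
    nonnesting w -> (forall x, x \in w -> count_mem x w = 2) ->
    a != b -> c != b ->
  subseq [:: a; b; b; c] w = subseq [:: a; b; c] (undup w).
Proof.
move=> w_nn w_twice neq_ab neq_cb.
have [b_w | b_w] := boolP (b \in w); last first.
  transitivity false; [| symmetry]; apply: contraNF b_w => /mem_subseq/(_ b).
    by rewrite !inE eqxx orbT => ->.
  by rewrite mem_undup !inE eqxx orbT => ->.
have [w1 [w' [w_def b_w1]]] := split_first b_w.
have b_w' : b \in w'.
  have := w_twice b b_w; rewrite w_def count_cat /= eqxx (count_memPn b_w1) -has_pred1 has_count.
  by rewrite add0n add1n => -[->].
have [w2 [w3 [w'_def b_w2]]] := split_first b_w'.
rewrite {}w'_def {w' b_w'} in w_def.
have b_w3 : b \notin w3.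
  apply/count_memPn; have := w_twice b b_w.
  by rewrite w_def count_cat /= eqxx count_cat /= eqxx; lia.
have -> : subseq [:: a; b; b; c] w = (a \in w1) && (c \in w3).
  rewrite w_def (@subseq_pivot b [:: a] [:: b; c]) ?mem_seq1 1?eq_sym //; last first.
    by rewrite count_cat /= eqxx (count_memPn b_w2) (count_memPn b_w3) (negPf neq_cb).
  rewrite (@subseq_pivot b [::] [:: c]) // ?(count_memPn b_w3) //.
  by rewrite sub0seq !sub1seq.
have undup_w : undup w = [seq x <- undup (w1 ++ b :: w2) | x \notin b :: w3] ++ b :: undup w3.
  by rewrite w_def -[b :: w2 ++ _]cat_cons catA undup_cat /= (negPf b_w3).
rewrite undup_w (@subseq_pivot b [:: a] [:: c]) ?mem_seq1 1?eq_sym //; first last.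
- by rewrite (count_memPn _) ?mem_undup.
- by rewrite mem_filter mem_head.
rewrite !sub1seq mem_undup; congr (_ && _).
rewrite mem_filter mem_undup mem_cat !inE negb_or (negPf neq_ab) /=.
have ab_nested := w_nn a b neq_ab; have ba_nested := w_nn b a.
rewrite eq_sym in ba_nested; move: {ba_nested}(ba_nested neq_ab) => ba_nested.
rewrite w_def in ab_nested ba_nested.
apply/idP/andP => [a_w1 | [a_w3]].
  rewrite a_w1; split=> //; apply: contra ab_nested => a_w3.
  apply: (@cat_subseq _ [:: a] [:: b; b; a]); rewrite ?sub1seq //= eqxx.
  by apply: (@cat_subseq _ [::] [:: b; a]); rewrite ?sub0seq //= eqxx sub1seq.
case/orP=> // a_w2; apply: contraNT ba_nested => a_w1.
have a_w : a \in w by rewrite w_def !(mem_cat, inE) a_w2 !orbT.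
have {a_w} := w_twice a a_w.
rewrite w_def count_cat /= count_cat /= (count_memPn a_w1) (count_memPn a_w3).
rewrite eq_sym (negPf neq_ab) !add0n addn0 => a_count.
apply: (@cat_subseq _ [::] [:: b; a; a; b]); rewrite ?sub0seq //= eqxx.
apply: (@cat_subseq _ [:: a; a] [:: b]); last by rewrite /= eqxx sub0seq.
have /all_pred1P := filter_all (pred1 a) w2; rewrite size_filter a_count /= => <-.
exact: filter_subseq.
Qed.

(** The two copies of [x] enclose the letters of [q] only, each of them once, so
    closing the head of the queue creates no nesting. *)
Lemma nonnesting_close x q w :
  uniq q -> x \notin q -> x \notin w -> nonnesting (q ++ w) ->
  nonnesting (x :: q ++ x :: w).
Proof.
move=> q_uniq x_q x_w qw_nn a b neq_ab; apply/negP => ab_nested.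
have [eq_ax | neq_ax] := eqVneq a x.
  (* then both letters b lie in q *)
  move: ab_nested; rewrite eq_ax /= eqxx => b_nested.
  have := @subseq_pivot x [:: b; b] [::] q w.
  rewrite /= !inE orbb -eq_ax neq_ab (count_memPn _) eq_ax // => /(_ isT x_q isT).
  rewrite b_nested sub0seq andbT => /esym/(leq_count_subseq (pred1 b)).
  by rewrite /= eqxx count_uniq_mem //; case: (b \in q).
have [eq_bx | neq_bx] := eqVneq b x.
  (* only one x is left after the first a *)
  move: ab_nested; rewrite /= eq_bx (negPf neq_ax) => /(leq_count_subseq (pred1 x)).
  rewrite /= eqxx (negPf neq_ax) count_cat /= eqxx.
  by rewrite (count_memPn x_q) (count_memPn x_w).
have := qw_nn a b neq_ab; rewrite -(@subseq_remove _ q w x); last first.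
  by rewrite !inE ![x == _]eq_sym (negPf neq_ax) (negPf neq_bx).
rewrite -(@subseq_remove _ [::] (q ++ x :: w) x) ?ab_nested //.
by rewrite !inE ![x == _]eq_sym (negPf neq_ax) (negPf neq_bx).
Qed.

Lemma completions_nonnesting p q w :
  uniq (q ++ p) -> w \in completions p q -> nonnesting (q ++ w).
Proof.
move=> qp_uniq w_in; move: p q w w_in qp_uniq.
apply: completions_ind => [q | x p q w w_in IHw | p y q w w_in IHw].
- rewrite cats0; elim: q => [|x q IHq] /=; first by [].
  by case/andP=> x_q q_uniq; apply: nonnesting_close => //; apply: IHq.
- by rewrite -!cat_rcons.
- rewrite cat_cons cons_uniq => /andP[y_notin qp_uniq]; move: (y_notin).
  rewrite mem_cat => /norP[y_q y_p].
  apply: nonnesting_close => //; last exact: IHw.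
    by move: qp_uniq; rewrite cat_uniq => /andP[].
  by rewrite (perm_mem (perm_completions w_in)) !mem_cat !negb_or y_q y_p.
Qed.

(** If the next letter [z] were in the queue behind its head [y], then the second
    [y], still to come, would close a nesting y z z y. *)
Lemma nonnesting_completions q w :
    uniq q -> (forall x, x \in q ++ w -> count_mem x (q ++ w) = 2) ->
    nonnesting (q ++ w) ->
  exists p, w \in completions p q.
Proof.
elim: w q => [|z w IHw] q q_uniq twice qw_nn.
  exists [::]; rewrite inE; case: q q_uniq twice {qw_nn} => // y q q_uniq /(_ y).
  by rewrite cats0 mem_head count_uniq_mem // mem_head => /(_ isT).
have [z_q | z_q] := boolP (z \in q); last first.
  have [|||p w_in] := IHw (rcons q z); rewrite ?cat_rcons //.
    by rewrite rcons_uniq z_q.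
  by exists (z :: p); apply: completions_first.
case: q q_uniq twice qw_nn z_q => // y q /andP[y_q q_uniq] twice qw_nn.
rewrite inE; case: eqVneq => [eq_zy _ | neq_zy /= z_q].
  rewrite {}eq_zy in twice qw_nn *.
  have y_qw : count_mem y (q ++ w) = 0.
    have := twice y (mem_head _ _); rewrite /= !count_cat /= eqxx; lia.
  have [||p w_in] := IHw q q_uniq.
  - move=> x x_in; have neq_yx : y != x.
      by apply: contraTneq x_in => <-; apply/count_memPn.
    have := twice x; rewrite !(mem_cat, inE).
    move: x_in; rewrite mem_cat => /orP[] -> /=; rewrite ?orbT => /(_ isT);
    by rewrite !count_cat /= (negPf neq_yx).
  - move=> a b neq_ab; apply: contra (qw_nn a b neq_ab) => /subseq_trans; apply.
    by rewrite (subseq_trans _ (subseq_cons _ _)) // subseq_cat2l subseq_cons.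
  by exists p; apply: completions_second.
have y_w : y \in w.
  have := twice y (mem_head _ _); rewrite /= eqxx count_cat /= (negPf neq_zy).
  by rewrite (count_memPn y_q) -has_pred1 has_count !add0n add1n => -[->].
have := qw_nn y z; rewrite eq_sym => /(_ neq_zy)/negP[].
by apply: (@cat_subseq _ [:: y; z] [:: z; y]); rewrite /= eqxx sub1seq.
Qed.

(** * Patterns in nonnesting words *)

Definition repeat_middle (t : triple) : seq nat := [:: t.1.1; t.1.2; t.1.2; t.2].

Lemma lt4_ind (P : nat -> Prop) : P 0 -> P 1 -> P 2 -> P 3 -> forall a, a < 4 -> P a.
Proof. by move=> P0 P1 P2 P3 [|[|[|[|]]]]. Qed.

(** The two middle letters of an occurrence are equal, so only the order of the
    three distinct letters remains to be compared. *)
Lemma contains_repeat_middle i j k w : uniq [:: i; j; k] ->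
  contains (repeat_middle (i, j, k)) w <->
  exists a b c, [/\ subseq [:: a; b; b; c] w, uniq [:: a; b; c]
                  & forbidden [:: (i, j, k)] (a < b) (a < c) (b < c)].
Proof.
rewrite /= !inE negb_or andbT => /andP[/andP[neq_ij neq_ik] neq_jk].
split=> [/containsP[t t_w [t_size t_order]] | [a [b [c [abbc_w]]]]].
  case: t t_size t_w t_order => [|a [|b [|b' [|c []]]]] // _ abbc_w order.
  have [/= ab_lt ab_eq] := order 0 1 isT isT.
  have [/= _] := order 1 2 isT isT; rewrite eqxx => /eqP eq_bb'.
  have [/= ac_lt ac_eq] := order 0 3 isT isT.
  have [/= bc_lt bc_eq] := order 1 3 isT isT.
  exists a, b, c; split; first by rewrite {2}eq_bb'.
    by rewrite /= !inE ab_eq ac_eq bc_eq (negPf neq_ij) (negPf neq_ik) (negPf neq_jk).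
  by rewrite /forbidden /= ab_lt ac_lt bc_lt !eqxx.
rewrite /= !inE negb_or andbT => /andP[/andP[neq_ab neq_ac] neq_bc].
rewrite /forbidden /= orbF => /and3P[/eqP ab_lt /eqP ac_lt /eqP bc_lt].
apply/containsP; exists [:: a; b; b; c] => //; split=> // x y.
move: x; apply: lt4_ind; move: y; apply: lt4_ind; rewrite /= ?ltnn ?eqxx //; lia.
Qed.

Lemma contains_1221 w :
  contains [:: 1; 2; 2; 1] w <-> exists a b, a < b /\ subseq [:: a; b; b; a] w.
Proof.
split=> [/containsP[t t_w [t_size t_order]] | [a [b [lt_ab abba_w]]]].
  case: t t_size t_w t_order => [|a [|b [|b' [|a' []]]]] // _ abba_w order.
  have [/= lt_ab _] := order 0 1 isT isT.
  have [/= _ /eqP eq_bb'] := order 1 2 isT isT.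
  have [/= _ /eqP eq_aa'] := order 0 3 isT isT.
  by exists a, b; split; rewrite // {2}eq_bb' {2}eq_aa'.
apply/containsP; exists [:: a; b; b; a] => //; split=> // x y.
move: x; apply: lt4_ind; move: y; apply: lt4_ind; rewrite /= ?ltnn ?eqxx //; lia.
Qed.

Lemma contains_2112 w :
  contains [:: 2; 1; 1; 2] w <-> exists a b, b < a /\ subseq [:: a; b; b; a] w.
Proof.
split=> [/containsP[t t_w [t_size t_order]] | [a [b [lt_ba abba_w]]]].
  case: t t_size t_w t_order => [|a [|b [|b' [|a' []]]]] // _ abba_w order.
  have [/= lt_ba _] := order 1 0 isT isT.
  have [/= _ /eqP eq_bb'] := order 1 2 isT isT.
  have [/= _ /eqP eq_aa'] := order 0 3 isT isT.
  by exists a, b; split; rewrite // {2}eq_bb' {2}eq_aa'.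
apply/containsP; exists [:: a; b; b; a] => //; split=> // x y.
move: x; apply: lt4_ind; move: y; apply: lt4_ind; rewrite /= ?ltnn ?eqxx //; lia.
Qed.

Lemma nonnestingP w :
  reflect (nonnesting w) (avoids [:: 1; 2; 2; 1] w && avoids [:: 2; 1; 1; 2] w).
Proof.
apply: (iffP andP) => [[no1221 no2112] x y neq_xy | w_nn].
  apply/negP => xyyx_w; case: (ltngtP x y) neq_xy => // lt_xy _.
    by move/negP: no1221; apply; apply/contains_1221; exists x, y.
  by move/negP: no2112; apply; apply/contains_2112; exists x, y.
split; apply/negP; [move/contains_1221 | move/contains_2112] => -[x [y [lt_xy]]];
  by apply/negP/w_nn; rewrite neq_ltn lt_xy ?orbT.
Qed.

Lemma pairwise_subseqP (r : rel nat) s :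
  reflect (forall y z, subseq [:: y; z] s -> r y z) (pairwise r s).
Proof.
apply: (iffP idP) => [s_r y z yz_s | s_r].
  by have := subseq_pairwise yz_s s_r; rewrite pairwise2.
elim: s s_r => //= x s IHs s_r; apply/andP; split.
  by apply/allP => y y_s; apply: s_r; rewrite eqxx sub1seq.
by apply: IHs => y z yz_s; apply: s_r; case: eqP => // _; apply: cons_subseq yz_s.
Qed.

Lemma avoids3P ts s :
  reflect (forall a b c, subseq [:: a; b; c] s -> ~~ forbidden ts (a < b) (a < c) (b < c))
          (avoids3 ts s).
Proof.
apply: (iffP idP) => [|s_ok].
  elim: s => //= x s IHs /andP[/pairwise_subseqP x_ok s_ok] a b c.
  by case: eqVneq => [-> | _]; [apply: x_ok | apply: IHs].
elim: s s_ok => //= x s IHs s_ok; apply/andP; split.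
  by apply/pairwise_subseqP => y z yz_s; apply: s_ok; rewrite eqxx.
by apply: IHs => a b c abc_s; apply: s_ok; case: eqP => // _; apply: cons_subseq abc_s.
Qed.

Lemma all_avoids_undup ts w :
    nonnesting w -> (forall x, x \in w -> count_mem x w = 2) ->
    all (fun t => uniq [:: t.1.1; t.1.2; t.2]) ts ->
  all (fun s => avoids s w) (map repeat_middle ts) = avoids3 ts (undup w).
Proof.
move=> w_nn w_twice /allP ts_uniq; rewrite all_map.
apply/allP/avoids3P => [w_avoids a b c abc_w | w_avoids [[i j] k] t_ts].
  apply/hasPn => -[[i j] k] t_ts; apply: contra (w_avoids _ t_ts) => ijk_abc.
  apply/contains_repeat_middle; first exact: ts_uniq t_ts.
  have abc_uniq := subseq_uniq abc_w (undup_uniq w).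
  exists a, b, c; split=> //; last by rewrite /forbidden /= orbF.
  move: abc_uniq; rewrite /= !inE negb_or andbT => /andP[/andP[neq_ab _] neq_bc].
  by rewrite subseq_repeat_middle // eq_sym.
apply/negP => /contains_repeat_middle [|a [b [c [abbc_w abc_uniq]]]].
  exact: ts_uniq t_ts.
move: abc_uniq; rewrite /= !inE negb_or andbT => /andP[/andP[neq_ab _] neq_bc].
rewrite /forbidden /= orbF => ijk_abc.
have := w_avoids a b c; rewrite -subseq_repeat_middle // 1?eq_sym // => /(_ abbc_w).
by apply/negP/negPn/hasP; exists (i, j, k).
Qed.

Lemma perm_doubled n : perm_eq (doubled n) (iota 1 n ++ iota 1 n).
Proof.
apply/permP => a; rewrite count_cat /doubled.
by elim: (iota 1 n) => //= x s ->; lia.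
Qed.

Lemma mem_nonnesting_perms n w :
  w \in nonnesting_perms n <->
  exists2 p, p \in permutations (iota 1 n) & w \in completions p [::].
Proof.
rewrite mem_filter mem_permutations; split=> [/andP[/nonnestingP w_nn w_perm] | [p]].
  have w_twice x : x \in w -> count_mem x w = 2.
    rewrite (permP (perm_trans w_perm (perm_doubled n))) count_cat.
    rewrite (perm_mem (perm_trans w_perm (perm_doubled n))) mem_cat orbb => x_in.
    by rewrite count_uniq_mem ?iota_uniq // x_in.
  have [p w_p] := @nonnesting_completions [::] w isT w_twice w_nn.
  exists p => //; rewrite mem_permutations.
  have := perm_trans w_perm (perm_doubled n); rewrite (permPl (perm_completions w_p)) /=.
  move/permP=> p_perm; apply/permP => a; have := p_perm a; rewrite !count_cat; lia.
rewrite mem_permutations => p_perm w_p.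
have p_uniq : uniq p by rewrite (perm_uniq p_perm) iota_uniq.
apply/andP; split; first exact/nonnestingP/(completions_nonnesting (q := [::]) _ w_p).
rewrite (permPl (perm_completions w_p)) perm_sym (permPl (perm_doubled n)) perm_sym /=.
exact: perm_cat.
Qed.

(** [g] recovers the block from any of its members, so the blocks are disjoint. *)
Lemma uniq_flatten_map (T U : eqType) (F : T -> seq U) (g : U -> T) s :
    uniq s -> (forall x, x \in s -> uniq (F x)) ->
    (forall x y, x \in s -> y \in F x -> g y = x) ->
  uniq (flatten (map F s)).
Proof.
elim: s => //= x s IHs /andP[x_s s_uniq] F_uniq gF.
rewrite cat_uniq F_uniq ?mem_head // IHs ?andbT //=; first last.
- by move=> z y z_s; apply: gF; rewrite inE z_s orbT.
- by move=> z z_s; apply: F_uniq; rewrite inE z_s orbT.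
apply/hasPn => y /flatten_mapP[z z_s y_z]; apply: contra x_s => y_x.
by rewrite -(gF x y) ?mem_head // (gF z y) // inE z_s orbT.
Qed.

(** The words are grouped by their permutation, which decides whether they avoid
    the patterns; each group has [catalan n] members. *)
Lemma c_leaves n ts : all (fun t => uniq [:: t.1.1; t.1.2; t.2]) ts ->
  c n (map repeat_middle ts) = leaves ts n 0 xpredT * catalan n.
Proof.
move=> ts_uniq; rewrite -count_avoids3 -size_filter /c.
set ps := filter (avoids3 ts) _.
have psP p : p \in ps -> uniq p /\ size p = n.
  rewrite mem_filter mem_permutations => /andP[_ p_perm].
  by rewrite (perm_uniq p_perm) iota_uniq (perm_size p_perm) size_iota.
transitivity (size (flatten [seq completions p [::] | p <- ps])).
  apply: perm_size; apply: uniq_perm => [||w].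
  - by rewrite !filter_uniq // permutations_uniq.
  - apply: (@uniq_flatten_map _ _ _ undup) => [|p /psP[p_uniq _]|p w /psP[p_uniq _]].
    + by rewrite filter_uniq // permutations_uniq.
    + exact: completions_uniq.
    + exact: undup_completions.
  have w_iff p : p \in permutations (iota 1 n) -> w \in completions p [::] ->
      all (fun s => avoids s w) (map repeat_middle ts) = avoids3 ts p.
    rewrite mem_permutations => p_perm w_p.
    have p_uniq : uniq p by rewrite (perm_uniq p_perm) iota_uniq.
    rewrite all_avoids_undup ?(undup_completions (q := [::]) _ w_p) //.
      exact: completions_nonnesting w_p.
    move=> x; rewrite (permP (perm_completions w_p)) (perm_mem (perm_completions w_p)).
    by rewrite /= count_cat mem_cat orbb count_uniq_mem // => ->.
  rewrite mem_filter; apply/andP/flatten_mapP => [[w_avoids] | [p]].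
    case/mem_nonnesting_perms=> p p_perm w_p; exists p => //.
    by rewrite mem_filter p_perm -w_iff ?w_avoids.
  rewrite mem_filter => /andP[p_avoids p_perm] w_p; rewrite (w_iff p) //; split=> //.
  by apply/mem_nonnesting_perms; exists p.
rewrite size_flatten sumnE !big_map big_seq.
rewrite (eq_bigr (fun=> catalan n)) => [|p /psP[_ p_size]].
  by rewrite -big_seq big_const_seq count_predT iter_addn_0 mulnC.
by rewrite size_completions p_size ballot_catalan.
Qed.

(** * The enumeration *)

Lemma c_leaves_succ m ts : all (fun t => uniq [:: t.1.1; t.1.2; t.2]) ts ->
  c m.+1 (map repeat_middle ts) = leaves ts m 1 xpredT * catalan m.+1.
Proof. by move=> ts_uniq; rewrite c_leaves // leaves_root. Qed.

Theorem theorem3p3 (n : nat) (hn : 1 <= n) :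
  (* (a) *)
  (forall i j k : nat, perm_eq [:: i; j; k] [:: 1; 2; 3] ->
     c n [:: [:: i; j; j; k]] = catalan n ^ 2) /\
  (* (b) *)
  [/\ c n [:: [:: 1; 2; 2; 3]; [:: 1; 3; 3; 2]] = 2 ^ (n - 1) * catalan n,
      c n [:: [:: 1; 3; 3; 2]; [:: 2; 1; 1; 3]] = 2 ^ (n - 1) * catalan n,
      c n [:: [:: 1; 3; 3; 2]; [:: 2; 3; 3; 1]] = 2 ^ (n - 1) * catalan n
    & c n [:: [:: 1; 3; 3; 2]; [:: 3; 1; 1; 2]] = 2 ^ (n - 1) * catalan n] /\
  (* (c) *)
  c n [:: [:: 1; 2; 2; 3]; [:: 2; 3; 3; 1]] = ('C(n, 2) + 1) * catalan n /\
  (* (d) *)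
  c n [:: [:: 1; 2; 2; 3]; [:: 1; 3; 3; 2]; [:: 2; 1; 1; 3]]
    = fib n * catalan n /\
  (* (e) *)
  [/\ c n [:: [:: 1; 2; 2; 3]; [:: 1; 3; 3; 2]; [:: 2; 3; 3; 1]]
        = n * catalan n,
      c n [:: [:: 1; 3; 3; 2]; [:: 2; 1; 1; 3]; [:: 2; 3; 3; 1]]
        = n * catalan n,
      c n [:: [:: 1; 2; 2; 3]; [:: 1; 3; 3; 2]; [:: 3; 1; 1; 2]]
        = n * catalan n,
      c n [:: [:: 1; 2; 2; 3]; [:: 2; 3; 3; 1]; [:: 3; 1; 1; 2]]
        = n * catalan n
    & n * catalan n = 'C(2 * n, n - 1)].
Proof.
split=> [i j k ijk_perm|].
  have ijk_uniq : uniq [:: i; j; k] by rewrite (perm_uniq ijk_perm).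
  rewrite (@c_leaves n [:: (i, j, k)]) ?all_seq1 //.
  rewrite -mulnn -ballot_catalan; congr (_ * _).
  have in123 x : x \in [:: i; j; k] -> [|| x == 1, x == 2 | x == 3].
    by rewrite (perm_mem ijk_perm) !inE.
  have := in123 i; have := in123 j; have := in123 k.
  rewrite !inE !eqxx !orbT => /(_ isT) k_in /(_ isT) j_in /(_ isT) i_in {in123 ijk_perm}.
  case/or3P: i_in ijk_uniq => /eqP->; case/or3P: j_in => /eqP->;
    case/or3P: k_in => /eqP-> // _.
  - by rewrite (@leaves123 n 0 0).
  - by rewrite (@leaves132 n 0 0).
  - by rewrite (@leaves213 n 0).
  - by rewrite (@leaves231 n 0).
  - by rewrite -(@leaves312 n 0 0) //; apply: eq_leaves => u; rewrite leqn0 => /eqP->.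
  - by rewrite -(@leaves321 n 0 0) //; apply: eq_leaves => u; rewrite leqn0 => /eqP->.
case: n hn => // m _; rewrite subn1 /=.
have sites01 u : u <= 1 -> xpredT u = (u == 0) || (u == 1) by case: u => [|[]].
have to01 ts : leaves ts m 1 xpredT = leaves ts m 1 (fun u => (u == 0) || (u == 1)).
  exact: eq_leaves.
split.
  split.
  - by rewrite (@c_leaves_succ m [:: (1, 2, 3); (1, 3, 2)]) // to01 leaves_123_132.
  - by rewrite (@c_leaves_succ m [:: (1, 3, 2); (2, 1, 3)]) // to01 leaves_132_213.
  - rewrite (@c_leaves_succ m [:: (1, 3, 2); (2, 3, 1)]) // leaves_132_231; congr (_ * _).
    (* the full row of the binomial coefficients *)
    rewrite addn0 -[2]/(1 + 1) expnDn; apply: eq_bigr => i _.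
    by rewrite !exp1n !muln1.
  - by rewrite (@c_leaves_succ m [:: (1, 3, 2); (3, 1, 2)]) // to01 leaves_132_312.
split.
  by rewrite (@c_leaves_succ m [:: (1, 2, 3); (2, 3, 1)]) // to01 leaves_123_231.
split.
  rewrite (@c_leaves_succ m [:: (1, 2, 3); (1, 3, 2); (2, 1, 3)]) // to01.
  by rewrite (leaves_123_132_213 m 0).2.
split.
- by rewrite (@c_leaves_succ m [:: (1, 2, 3); (1, 3, 2); (2, 3, 1)]) // to01 leaves_123_132_231.
- by rewrite (@c_leaves_succ m [:: (1, 3, 2); (2, 1, 3); (2, 3, 1)]) // to01 leaves_132_213_231.
- by rewrite (@c_leaves_succ m [:: (1, 2, 3); (1, 3, 2); (3, 1, 2)]) // to01 leaves_123_132_312.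
- by rewrite (@c_leaves_succ m [:: (1, 2, 3); (2, 3, 1); (3, 1, 2)]) // to01 leaves_123_231_312.
- by rewrite mul_catalan // subn1.
Qed.
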